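(* Let $n\in\mathbb{N}$, let $H\subseteq\mathbb{R}$ with $|H|\ge n+2$, let $\omega=(\omega_1,\dots,\omega_n):H\to\mathbb{R}^n$ be an $n$-dimensional positive Chebyshev system over $H$, and let $\omega_{n+1}:H\to\mathbb{R}$ be such that $\omega^*=(\omega_1,\dots,\omega_n,\omega_{n+1})$ is an $(n+1)$-dimensional positive Chebyshev system over $H$. Let $m\in\mathbb{N}$ with $n\le m\le |H|-1$ and let $x_0<\dots<x_m$ be elements of $H$. Then, for all integers $0\le i_0<\dots<i_n\le m$, there exist $A_0,\dots,A_{m-n}\in[0,1]$ with $\sum_{i=0}^{m-n}A_i=1$ such that, for every function $f:\{x_0,\dots,x_m\}\to\mathbb{R}$, $$\big[x_{i_0},\dots,x_{i_n};f\big]_{\omega^*}=\sum_{i=0}^{m-n}A_i\big[x_i,\dots,x_{i+n};f\big]_{\omega^*}.$$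
   Context: $\mathbb{N}$ is the set of positive integers. For $H\subseteq\mathbb{R}$ and $k\in\mathbb{N}$, $\sigma_k(H):=\{(x_1,\dots,x_k)\in H^k\mid x_1<\dots<x_k\}$. For $\omega=(\omega_1,\dots,\omega_k):H\to\mathbb{R}^k$ and $(x_1,\dots,x_k)\in\sigma_k(H)$, $\Phi_\omega(x_1,\dots,x_k):=\det\big(\omega_i(x_j)\big)_{i,j=1}^k$. $\omega$ is a $k$-dimensional positive Chebyshev system over $H$ if $\Phi_\omega>0$ on $\sigma_k(H)$ (where $|H|\ge k$). For an $n$-dimensional $\omega$ and a real function $f$, $(\omega,f):=(\omega_1,\dots,\omega_n,f)$. The generalized $\omega^*$-divided difference of a real function $f$ (defined at the points involved) is $$[x_0,\dots,x_n;f]_{\omega^*}:=\frac{\Phi_{(\omega,f)}(x_0,\dots,x_n)}{\Phi_{\omega^*}(x_0,\dots,x_n)}\qquad\text{for } (x_0,\dots,x_n)\in\sigma_{n+1}(H).$$ If $H$ is infinite, the condition $m\le|H|-1$ is vacuous. *)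

(* Defs.v *)
From mathcomp Require Import all_boot all_order all_algebra.
From mathcomp Require Import boolp classical_sets functions cardinality reals.

Set Implicit Arguments.
Unset Strict Implicit.
Unset Printing Implicit Defensive.

Import Order.TTheory GRing.Theory Num.Theory.

Local Open Scope classical_set_scope.
Local Open Scope card_scope.
Local Open Scope ring_scope.

(* Functions defined on a subset of R are represented by total functions
   R -> R; the notions below only use their values at points of the subset.
   A k-tuple of functions (omega_1, ..., omega_k) is indexed by 'I_k, so that
   omega_i is [omega] at the ordinal i - 1. *)

Definition sigma (R : realType) (k : nat) (H : set R) : set ('I_k -> R) :=
  [set x | (forall i, H (x i)) /\
           (forall i j : 'I_k, (i < j)%N -> x i < x j)].
Arguments sigma {R} k H _.

Definition Phi (R : realType) (k : nat) (omega : 'I_k -> R -> R)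
    (x : 'I_k -> R) : R :=
  \det (\matrix_(i < k, j < k) omega i (x j)).

(* [`I_k #<= H] says |H| >= k, for H finite or infinite. *)
Definition positive_Chebyshev_system (R : realType) (k : nat) (H : set R)
    (omega : 'I_k -> R -> R) : Prop :=
  (`I_k #<= H) /\ (forall x : 'I_k -> R, sigma k H x -> 0 < Phi omega x).

(* (omega_1, ..., omega_n, f): f is put at the last index [ord_max]. *)
Definition extend (R : realType) (n : nat) (omega : 'I_n -> R -> R)
    (f : R -> R) : 'I_n.+1 -> R -> R :=
  fun i => if unlift ord_max i is Some j then omega j else f.

(* [x_0, ..., x_n; f]_{omega*} for omega* = (omega, w). *)
Definition divided_difference (R : realType) (n : nat)
    (omega : 'I_n -> R -> R) (w : R -> R) (x : 'I_n.+1 -> R) (f : R -> R) : R :=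
  Phi (extend omega f) x / Phi (extend omega w) x.

(* The consecutive points x_i, ..., x_{i+n}. The default value of [inord] is
   never used when i + n <= m. *)
Definition window (R : realType) (n m : nat) (x : 'I_m.+1 -> R) (i : nat) :
    'I_n.+1 -> R :=
  fun k => x (inord (i + k)).
Arguments window {R} n {m} x i _.

(* Main.v *)
(* Removing an interior point from n + 2 points y_0 < ... < y_{n+1} gives a
   divided difference that is a convex combination of those obtained by
   removing y_0 and y_{n+1}.  Indeed, if g is a combination of
   omega_1, ..., omega_n, expanding the determinant with rows omega, f, g along
   g yields
   sum_k (-1)^k g(y_k) Phi_(omega, f)(y without y_k) = 0; choosing g to vanish
   at all interior points but one leaves a three-term relation, and the signs
   of its coefficients are read off by taking for f the indicators of y_0 and
   y_{n+1}.  Filling a gap of the index sequence i and removing either extreme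
   index shortens i_n - i_0, so induction on this length concludes. *)
Require Import Defs.
From mathcomp Require Import all_boot all_order all_algebra.
From mathcomp Require Import boolp classical_sets functions cardinality reals.
From mathcomp Require Import zify ring.

Set Implicit Arguments.
Unset Strict Implicit.
Unset Printing Implicit Defensive.

Import Order.TTheory GRing.Theory Num.Theory.

Local Open Scope classical_set_scope.
Local Open Scope card_scope.
Local Open Scope ring_scope.

Lemma ltn_lift (n : nat) (a : 'I_n.+1) (j k : 'I_n) :
  (j < k)%N -> (lift a j < lift a k)%N.
Proof. by rewrite /= /bump; lia. Qed.

Lemma extend_lift (R : realType) (n : nat) (omega : 'I_n -> R -> R)
    (f : R -> R) (j : 'I_n) : extend omega f (lift ord_max j) = omega j.
Proof. by rewrite /extend liftK. Qed.

Lemma extend_max (R : realType) (n : nat) (omega : 'I_n -> R -> R)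
    (f : R -> R) : extend omega f ord_max = f.
Proof. by rewrite /extend unlift_none. Qed.

Lemma Phi_eq_points (R : realType) (n : nat) (omega : 'I_n -> R -> R)
    (x : 'I_n -> R) (a b : 'I_n) : a != b -> x a = x b -> Phi omega x = 0.
Proof.
move=> neq_ab eq_x; rewrite /Phi -det_tr (determinant_alternate neq_ab) //.
by move=> k; rewrite !mxE eq_x.
Qed.

Lemma Phi_extend (R : realType) (n : nat) (omega : 'I_n -> R -> R)
    (f : R -> R) (x : 'I_n.+1 -> R) :
  Phi (extend omega f) x =
  \sum_(k < n.+1) (-1) ^+ (n + k) * f (x k) * Phi omega (x \o lift k).
Proof.
rewrite /Phi (expand_det_row _ ord_max); apply: eq_bigr => k _.
rewrite mxE extend_max /cofactor mulrCA mulrA; congr (_ * \det _).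
by apply/matrixP => a b; rewrite !mxE extend_lift.
Qed.

(** This is the expansion along its last row of the determinant with rows [omega] and [omega a],
    which has a repeated row. *)
Lemma sum_Phi_lift (R : realType) (n : nat) (omega : 'I_n -> R -> R)
    (x : 'I_n.+1 -> R) (a : 'I_n) :
  \sum_(k < n.+1) (-1) ^+ (n + k) * omega a (x k) * Phi omega (x \o lift k) = 0.
Proof.
rewrite -(Phi_extend omega (omega a)) /Phi.
apply: (determinant_alternate (i1 := lift ord_max a) (i2 := ord_max)).
  by rewrite eq_sym neq_lift.
by move=> k; rewrite !mxE extend_lift extend_max.
Qed.

(** Indicators isolate one minor of the expansion, whose sign is known for a Chebyshev system. *)
Lemma Phi_indicator (R : realType) (n : nat) (omega : 'I_n -> R -> R)
    (x : 'I_n.+1 -> R) (k : 'I_n.+1) : injective x ->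
  Phi (extend omega (fun t => (t == x k)%:R)) x =
  (-1) ^+ (n + k) * Phi omega (x \o lift k).
Proof.
move=> inj_x; rewrite Phi_extend (bigD1 k) //= eqxx mulr1 big1 ?addr0 //.
by move=> l neq_lk; rewrite (inj_eq inj_x) (negPf neq_lk) mulr0 mul0r.
Qed.

Lemma Phi_indicator_out (R : realType) (n : nat) (omega : 'I_n -> R -> R)
    (x : 'I_n.+1 -> R) (s : R) : (forall k, x k != s) ->
  Phi (extend omega (fun t => (t == s)%:R)) x = 0.
Proof.
move=> hs; rewrite Phi_extend big1 // => k _.
by rewrite (negPf (hs k)) mulr0 mul0r.
Qed.

Lemma sigma_inj (R : realType) (n : nat) (H : set R) (x : 'I_n -> R) :
  sigma n H x -> injective x.
Proof.
move=> [_ lt_x] a b eq_x; apply/val_inj/eqP.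
by case: ltngtP => // /lt_x; rewrite eq_x ltxx.
Qed.

Lemma sigma_comp (R : realType) (n p : nat) (H : set R) (x : 'I_n -> R)
    (h : 'I_p -> 'I_n) :
  (forall j k : 'I_p, (j < k)%N -> (h j < h k)%N) ->
  sigma n H x -> sigma p H (x \o h).
Proof. by move=> lt_h [Hx lt_x]; split=> [a|a b /lt_h /lt_x] //=. Qed.

Lemma sigma_lift (R : realType) (n : nat) (H : set R) (x : 'I_n.+1 -> R)
    (a : 'I_n.+1) : sigma n.+1 H x -> sigma n H (x \o lift a).
Proof. by apply: sigma_comp => j k; apply: ltn_lift. Qed.

(** The values are the interior indices 1, ..., n. The form is the one produced by [big_ord_recl]
    followed by [big_ord_recr]. *)
Definition inner {n : nat} (j : 'I_n) : 'I_n.+2 :=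
  lift ord0 (widen_ord (leqnSn n) j).

Lemma Phi_three_terms (R : realType) (n : nat) (H : set R)
    (omega : 'I_n -> R -> R) (y : 'I_n.+2 -> R) (j : 'I_n) :
  positive_Chebyshev_system H omega -> sigma n.+2 H y ->
  exists a b : R, forall f, Phi (extend omega f) (y \o lift (inner j)) =
    a * Phi (extend omega f) (y \o lift ord0) +
    b * Phi (extend omega f) (y \o lift ord_max).
Proof.
move=> [_ pos] sy.
(* As a function of t, [g] is the determinant at the interior points with the j-th one replaced by
   t: it vanishes at the other interior points by a repeated column, and is positive at the j-th. *)
pose z t (l : 'I_n) := if l == j then t else y (inner l).
pose g t := Phi omega (z t).
(* These cofactors delete column j, the only one involving t, so the value 0 is arbitrary. *)
pose c a := cofactor (\matrix_(a < n, l < n) omega a (z 0 l)) a j.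
have gE t : g t = \sum_a omega a t * c a.
  rewrite /g /Phi (expand_det_col _ j); apply: eq_bigr => a _.
  rewrite mxE /z eqxx; congr (_ * (_ * \det _)).
  by apply/matrixP => p q; rewrite !mxE /z eq_sym (negPf (neq_lift _ _)).
have g_inner l : l != j -> g (y (inner l)) = 0.
  move=> neq_lj; apply: (Phi_eq_points _ neq_lj).
  by rewrite /z eqxx (negPf neq_lj).
have g_j : g (y (inner j)) != 0.
  rewrite gt_eqF //; have -> : g (y (inner j)) = Phi omega (y \o inner).
    by congr Phi; apply: funext => l; rewrite /z /=; case: eqP => [->|].
  by apply/pos/(sigma_comp _ sy) => k l.
(* Apply [sum_Phi_lift] to the system [extend omega f] at each row [omega r], and sum with the
   weights [c r]. *)
have rel f : \sum_(k < n.+2) (-1) ^+ (n.+1 + k) * g (y k) *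
    Phi (extend omega f) (y \o lift k) = 0.
  transitivity (\sum_r c r * \sum_(k < n.+2) (-1) ^+ (n.+1 + k) *
      extend omega f (lift ord_max r) (y k) *
      Phi (extend omega f) (y \o lift k)); last first.
    by rewrite big1 // => a _; rewrite sum_Phi_lift mulr0.
  under [RHS]eq_bigr do rewrite mulr_sumr.
  rewrite exchange_big; apply: eq_bigr => k _.
  rewrite gE [X in X * _]mulr_sumr mulr_suml; apply: eq_bigr => a _.
  by rewrite extend_lift; ring.
pose e (k : 'I_n.+2) := (-1) ^+ (n.+1 + k) * g (y k).
have ej : e (inner j) != 0 by rewrite mulf_neq0 ?signr_eq0.
exists (- e ord0 / e (inner j)), (- e ord_max / e (inner j)) => f.
move: (rel f); rewrite big_ord_recl big_ord_recr /=.
rewrite (bigD1 j) //= big1 => [|l neq_lj]; last first.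
  by rewrite g_inner // mulr0 mul0r.
have -> : lift ord0 ord_max = ord_max :> 'I_n.+2 by apply: val_inj.
rewrite addr0 -/(inner j) -/(e ord0) -/(e (inner j)).
rewrite -[(-1) ^+ _ * g (y ord_max)]/(e ord_max).
move=> eq0; apply: (mulfI ej).
transitivity (- (e ord0 * Phi (extend omega f) (y \o lift ord0) +
                 e ord_max * Phi (extend omega f) (y \o lift ord_max))).
  apply/eqP; rewrite -addr_eq0 -[eqbRHS]eq0; apply/eqP.
  by ring.
by field.
Qed.

Lemma divided_difference_inner (R : realType) (n : nat) (H : set R)
    (omega : 'I_n -> R -> R) (w : R -> R) (y : 'I_n.+2 -> R) (j : 'I_n) :
  positive_Chebyshev_system H omega ->
  positive_Chebyshev_system H (extend omega w) -> sigma n.+2 H y ->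
  exists a b : R, [/\ 0 <= a, 0 <= b, a + b = 1 & forall f,
    divided_difference omega w (y \o lift (inner j)) f =
    a * divided_difference omega w (y \o lift ord0) f +
    b * divided_difference omega w (y \o lift ord_max) f].
Proof.
move=> Tomega Tw sy; have [a [b relE]] := Phi_three_terms j Tomega sy.
have inj_y := sigma_inj sy.
have inj_lift k : injective (y \o lift k) := sigma_inj (sigma_lift k sy).
have pos k l : 0 < Phi omega ((y \o lift k) \o lift l).
  by apply: Tomega.2; do 2!apply: sigma_lift.
have posw k : 0 < Phi (extend omega w) (y \o lift k).
  by apply/Tw.2/sigma_lift.
have out k : forall l, (y \o lift k) l != y k.
  by move=> l /=; rewrite (inj_eq inj_y) eq_sym neq_lift.
(* The indicator of y_0 kills the term in [a]. In the other two determinants y_0 is the first point,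
   so both carry the same sign, which cancels; [b] times one positive minor equals another. *)
have b_gt0 : 0 < b.
  have lift_0 (k : 'I_n.+2) : k != ord0 -> (y \o lift k) ord0 = y ord0.
    move=> k_neq0; congr y; apply: val_inj; rewrite /= /bump.
    by move: k_neq0; rewrite -val_eqE /= -lt0n addn0; case: (k : nat).
  have := relE (fun t => (t == y ord0)%:R).
  rewrite (Phi_indicator_out _ (out _)) mulr0 add0r.
  rewrite -{1}(lift_0 (inner j)) // -(lift_0 ord_max) //.
  rewrite !Phi_indicator // mulrCA => /(mulfI (negbT (signr_eq0 _ _))) eq_b.
  by have := pos (inner j) ord0; rewrite eq_b pmulr_lgt0.
(* Symmetrically, with the indicator of the last point, which kills the term in [b]. *)
have a_gt0 : 0 < a.
  have lift_max (k : 'I_n.+2) :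
      k != ord_max -> (y \o lift k) ord_max = y ord_max.
    move=> k_neq; congr y; apply: val_inj; rewrite /= /bump.
    by move: k_neq; rewrite -val_eqE /=; have := ltn_ord k; lia.
  have := relE (fun t => (t == y ord_max)%:R).
  rewrite (Phi_indicator_out _ (out _)) mulr0 addr0.
  have inner_neq : inner j != ord_max.
    by rewrite -val_eqE /= /bump; have := ltn_ord j; lia.
  rewrite -{1}(lift_max (inner j)) // -(lift_max ord0) //.
  rewrite !Phi_indicator // mulrCA => /(mulfI (negbT (signr_eq0 _ _))) eq_a.
  by have := pos (inner j) ord_max; rewrite eq_a pmulr_lgt0.
pose W k := Phi (extend omega w) (y \o lift k).
have Wneq0 k : W k != 0 by rewrite gt_eqF ?posw.
exists (a * W ord0 / W (inner j)), (b * W ord_max / W (inner j)); split.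
- by rewrite divr_ge0 ?mulr_ge0 // ltW ?posw.
- by rewrite divr_ge0 ?mulr_ge0 // ltW ?posw.
(* The weights sum to 1 by the three-term relation at f = [w]. *)
- by rewrite -mulrDl -relE divff ?Wneq0.
- move=> f; rewrite /divided_difference relE -!/(W _).
  by field; rewrite !Wneq0.
Qed.

Theorem theorem2 (R : realType) (n : nat) (hn : (0 < n)%N)
    (H : set R) (hH : `I_n.+2 #<= H)
    (omega : 'I_n -> R -> R) (homega : positive_Chebyshev_system H omega)
    (w : R -> R) (hw : positive_Chebyshev_system H (extend omega w))
    (m : nat) (hnm : (n <= m)%N) (hmH : `I_m.+1 #<= H)
    (x : 'I_m.+1 -> R) (hx : sigma m.+1 H x)
    (i : 'I_n.+1 -> 'I_m.+1)
    (hi : forall j k : 'I_n.+1, (j < k)%N -> (i j < i k)%N) :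
  exists A : 'I_(m - n).+1 -> R,
    [/\ forall l, 0 <= A l <= 1,
        \sum_(l < (m - n).+1) A l = 1 &
        forall f : R -> R,
          divided_difference omega w (fun k => x (i k)) f =
          \sum_(l < (m - n).+1)
             A l * divided_difference omega w (window n x l) f].
Proof.
suff [A [A_ge0 sumA AE]] : exists A : 'I_(m - n).+1 -> R,
    [/\ forall l, 0 <= A l, \sum_(l < (m - n).+1) A l = 1 &
      forall f : R -> R, divided_difference omega w (x \o i) f =
        \sum_(l < (m - n).+1) A l * divided_difference omega w (window n x l) f].
  exists A; split=> // l; rewrite A_ge0 -sumA (bigD1 l) //= lerDl.
  by apply: sumr_ge0.
have [d] := ubnP (i ord_max - i ord0)%N.
elim: d i hi => // d IH i hi lt_d.
have [/existsP[k gap] | nogap] :=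
  boolP [exists k : 'I_n, ((i (widen_ord (leqnSn n) k)).+1 < i (lift ord0 k))%N].
  have i_le (p q : 'I_n.+1) : (p <= q)%N -> (i p <= i q)%N.
    by rewrite leq_eqVlt => /orP[/eqP/val_inj->//|/hi/ltnW].
  have lt_p : ((i (widen_ord (leqnSn n) k)).+1 < m.+1)%N.
    exact: ltn_trans gap (ltn_ord _).
  (* [J] inserts i_k + 1 between i_k and i_(k+1), at position k + 1; skipping that position gives
     back [i]. *)
  pose J l := if unlift (inner k) l is Some a then i a else Ordinal lt_p.
  have J_lift a : J (lift (inner k) a) = i a by rewrite /J liftK.
  have J_inner : J (inner k) = Ordinal lt_p by rewrite /J unlift_none.
  have hJ (p q : 'I_n.+2) : (p < q)%N -> (J p < J q)%N.
    case: (unliftP (inner k) p) => [a|] ->;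
      case: (unliftP (inner k) q) => [b|] ->;
      rewrite ?J_lift ?J_inner ?ltnn // => lt_pq.
    - by apply: hi; move: lt_pq; rewrite /= /bump; lia.
    - rewrite /= ltnS; apply: i_le; move: lt_pq; rewrite /= /bump; lia.
    - apply: leq_trans gap _; apply: i_le; move: lt_pq; rewrite /= /bump; lia.
  have J0 : J ord0 = i ord0.
    by rewrite -J_lift; congr J; apply: val_inj.
  have Jmax : J ord_max = i ord_max.
    rewrite -J_lift; congr J; apply: val_inj => /=.
    by rewrite /bump /=; have := ltn_ord k; lia.
  (* Subtraction on naturals truncates: this ensures that dropping an extreme index really decreases
     the length. *)
  have lt_ends : (J ord0 < J ord_max)%N by apply: hJ.
  have short_ord0 : ((J \o lift ord0) ord_max - (J \o lift ord0) ord0 < d)%N.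
    have := hJ ord0 (lift ord0 ord0) isT; rewrite -Jmax -J0 in lt_d *.
    rewrite /= (_ : lift ord0 ord_max = ord_max); last exact: val_inj.
    by lia.
  have short_max :
      ((J \o lift ord_max) ord_max - (J \o lift ord_max) ord0 < d)%N.
    have lt_max : (lift (@ord_max n.+1) ord_max < @ord_max n.+1)%N
      by rewrite lift_max.
    have := hJ _ _ lt_max; rewrite -Jmax -J0 in lt_d *.
    rewrite /= (_ : lift ord_max ord0 = ord0); last exact: val_inj.
    by lia.
  have [A [A_ge0 sumA AE]] := IH (J \o lift ord0)
    (fun p q lt_pq => hJ _ _ (ltn_lift _ lt_pq)) short_ord0.
  have [B [B_ge0 sumB BE]] := IH (J \o lift ord_max)
    (fun p q lt_pq => hJ _ _ (ltn_lift _ lt_pq)) short_max.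
  have [a [b [a_ge0 b_ge0 sum_ab abE]]] :=
    divided_difference_inner k homega hw (sigma_comp hJ hx).
  exists (fun l => a * A l + b * B l); split=> [l||f].
  - by rewrite addr_ge0 ?mulr_ge0.
  - by rewrite big_split -!mulr_sumr /= sumA sumB !mulr1.
  - have -> : x \o i = (x \o J) \o lift (inner k).
      by apply: funext => l; rewrite /= J_lift.
    rewrite abE; rewrite -[(x \o J) \o _]/(x \o (J \o _)) AE.
    rewrite -[(x \o J) \o _]/(x \o (J \o _)) BE.
    rewrite !mulr_sumr -big_split; apply: eq_bigr => l _ /=.
    by ring.
(* Without a gap the points form the single window starting at i_0, so all the weight goes there. *)
have consecutive k (lt_k : (k < n.+1)%N) :
    i (Ordinal lt_k) = (i ord0 + k)%N :> nat.
  elim: k lt_k => [|k IHk] lt_k; first by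
    rewrite addn0; congr (nat_of_ord (i _)); apply: val_inj.
  have lt_kn : (k < n)%N by [].
  have := IHk (ltnW lt_k).
  have := hi (Ordinal (ltnW lt_k)) (Ordinal lt_k) (ltnSn k).
  move: nogap; rewrite negb_exists => /forallP/(_ (Ordinal lt_kn)).
  rewrite (_ : widen_ord _ _ = Ordinal (ltnW lt_k)); last exact: val_inj.
  rewrite (_ : lift _ _ = Ordinal lt_k); last exact: val_inj.
  by lia.
have i0_lt : (i ord0 < (m - n).+1)%N.
  have := ltn_ord (i ord_max); rewrite consecutive; lia.
exists (fun l => (l == Ordinal i0_lt)%:R); split=> [l||f].
- exact: ler0n.
- by rewrite (bigD1 (Ordinal i0_lt)) //= eqxx big1 ?addr0 // => l /negPf->.
- rewrite (bigD1 (Ordinal i0_lt)) //= eqxx mul1r big1 ?addr0; last first.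
    by move=> l /negPf->; rewrite mul0r.
  congr divided_difference; apply: funext => k; rewrite /window /=; congr x.
  (* [inord] does not take its default value, since i_0 + k = i_k is a valid index. *)
  apply: val_inj; case: k => k lt_k; rewrite /= consecutive inordK //.
  by rewrite -consecutive.
Qed.
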